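(* Let $N$ be a regular ruled surface in $E^3$ with parametrization $\vec r(s,v)=\vec c(s)+v\vec q(s)$, $\|\vec q(s)\|=1$, where $\vec c$ is the striction curve of $N$ and $s$ is the arc length parameter of $\vec c$, with Frenet frame $\{\vec q,\vec h,\vec a\}$ and non-zero invariants $k_1,k_2$. Then $N$ is a $q$-slant ruled surface if and only if $\det(\vec q\,',\vec q\,'',\vec q\,''')=0$ for all $s$.
   Context: All maps are smooth and defined on an open interval $I\subset\mathbb R$; $E^3$ is Euclidean 3-space. $N$ is given by $\vec r(s,v)=\vec c(s)+v\vec q(s)$, where $\vec c$ is a unit speed curve and $\vec q$ is a unit vector field along $\vec c$ (the ruling). ''Regular'' refers to the base curve $\vec c$ being a regular curve (here unit speed); points where $\vec r$ fails to be an immersion are not excluded. That $\vec c$ is the striction curve means $\langle \vec c\,',\vec q\,'\rangle=0$. Frenet frame of $N$: $\vec a=\dfrac{\vec q\times\vec q\,'}{\|\vec q\,'\|}$ (central tangent), $\vec h=\vec a\times\vec q$ (central normal). The invariants $k_1,k_2$ are the functions in the Frenet formulae $$\vec q\,'=k_1\vec h,\qquad \vec h'=-k_1\vec q+k_2\vec a,\qquad \vec a'=-k_2\vec h,$$ with $'=d/ds$; both are assumed nowhere zero (so $k_1=\|\vec q\,'\|>0$). $N$ is called $q$-slant if there is a fixed unit vector $\vec u$ and a constant angle $\theta\neq\pi/2$ with $\langle\vec q(s),\vec u\rangle=\cos\theta$ for all $s$. *)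

(* Defs.v *)
From HB Require Import structures.
From mathcomp Require Import all_boot all_order all_algebra.
From mathcomp Require Import all_classical all_reals all_analysis.

Set Implicit Arguments.
Unset Strict Implicit.
Unset Printing Implicit Defensive.

Import Order.TTheory GRing.Theory Num.Theory.
Import numFieldNormedType.Exports.

Local Open Scope ring_scope.
Local Open Scope classical_set_scope.

Definition dot (R : realType) (u v : 'rV[R]_3) : R := (u *m v^T) 0 0.

(* The library norm on 'rV[R]_3 is the sup norm, so the Euclidean one is
   introduced separately. *)
Definition enorm (R : realType) (u : 'rV[R]_3) : R := Num.sqrt (dot u u).

(* Coordinates are indexed modulo 3 by the ring structure of 'I_3, whence the
   cyclic formula. *)
Definition cross (R : realType) (u v : 'rV[R]_3) : 'rV[R]_3 :=
  \row_(j < 3) (u 0 (j + 1) * v 0 (j + 2%:R) - u 0 (j + 2%:R) * v 0 (j + 1)).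

Definition det3 (R : realType) (u v w : 'rV[R]_3) : R :=
  \det (\matrix_(i < 3) [:: u; v; w]`_i).

(* Meant for an open D, so that the two-sided derivatives at points of D do not
   depend on the values of f outside D. *)
Definition smooth_on (R : realType) (V : normedModType R) (D : set R)
    (f : R -> V) : Prop :=
  forall (n : nat) (s : R), D s -> derivable (derive1n n f) s 1.

Record ruledSurface (R : realType) := RuledSurface {
  dom : set R;
  base : R -> 'rV[R]_3;
  ruling : R -> 'rV[R]_3;
  param : R -> R -> 'rV[R]_3;
  dom_open : open dom;
  dom_interval : is_interval dom;
  base_smooth : smooth_on dom base;
  ruling_smooth : smooth_on dom ruling;
  ruling_unit : forall s, dom s -> enorm (ruling s) = 1;
  paramE : forall s v, dom s -> param s v = base s + v *: ruling s
}.

Definition unit_speed (R : realType) (N : ruledSurface R) : Prop :=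
  forall s, dom N s -> enorm (derive1 (base N) s) = 1.

Definition striction_base (R : realType) (N : ruledSurface R) : Prop :=
  forall s, dom N s -> dot (derive1 (base N) s) (derive1 (ruling N) s) = 0.

Definition central_tangent (R : realType) (N : ruledSurface R) (s : R) :
    'rV[R]_3 :=
  (enorm (derive1 (ruling N) s))^-1 *: cross (ruling N s) (derive1 (ruling N) s).

Definition central_normal (R : realType) (N : ruledSurface R) (s : R) :
    'rV[R]_3 :=
  cross (central_tangent N s) (ruling N s).

(* k1 and k2 are the functions in the Frenet formulae.  As 0^-1 = 0, the
   condition that the frame exists at s has to be stated explicitly. *)
Definition frenet_invariants (R : realType) (N : ruledSurface R)
    (k1 k2 : R -> R) : Prop :=
  forall s, dom N s ->
    [/\ derive1 (ruling N) s != 0,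
        derive1 (ruling N) s = k1 s *: central_normal N s,
        derive1 (central_normal N) s =
          - k1 s *: ruling N s + k2 s *: central_tangent N s
      & derive1 (central_tangent N) s = - k2 s *: central_normal N s].

Definition q_slant (R : realType) (N : ruledSurface R) : Prop :=
  exists (u : 'rV[R]_3) (theta : R),
    [/\ enorm u = 1,
        0 <= theta <= pi,
        theta != pi / 2
      & forall s, dom N s -> dot (ruling N s) u = cos theta].

(* Main.v *)
Require Import Defs.
From HB Require Import structures.
From mathcomp Require Import all_boot all_order all_algebra.
From mathcomp Require Import all_classical all_reals all_analysis.
From mathcomp Require Import ring.

Set Implicit Arguments.
Unset Strict Implicit.
Unset Printing Implicit Defensive.

Import Order.TTheory GRing.Theory Num.Theory.
Import numFieldNormedType.Exports.

Local Open Scope ring_scope.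
Local Open Scope classical_set_scope.

(* If <q, u> is constant then q', q'' and q''' are all orthogonal to u <> 0,
   hence dependent.  Conversely, let w = q' x q'', which vanishes nowhere since
   <q, w> is a nonzero multiple of k1 k2.  As w' = q' x q''', the curve w x w'
   equals det(q', q'', q''') q' = 0, so the direction u = w / |w| is constant;
   then <q, u>' = <q', u> = 0 and <q, u> <> 0. *)

(** * Vector algebra in coordinates *)

Lemma forall_ord3 (P : 'I_3 -> Prop) : P 0 -> P 1 -> P 2%:R -> forall j, P j.
Proof.
move=> P0 P1 P2 [[|[|[|//]]] lt_j3]; [move: P0|move: P1|move: P2];
  by congr P; apply/val_inj.
Qed.

Lemma rV3P (R : realType) (u v : 'rV[R]_3) :
  u 0 0 = v 0 0 -> u 0 1 = v 0 1 -> u 0 2%:R = v 0 2%:R -> u = v.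
Proof.
by move=> e0 e1 e2; apply/rowP; elim/forall_ord3.
Qed.

Lemma dotE (R : realType) (u v : 'rV[R]_3) :
  dot u v = u 0 0 * v 0 0 + u 0 1 * v 0 1 + u 0 2%:R * v 0 2%:R.
Proof.
rewrite /dot mxE !big_ord_recl big_ord0 !mxE addr0 addrA.
by congr (_ * _ + _ * _ + _ * _); congr (_ _ _); apply/val_inj.
Qed.

Lemma cross0E (R : realType) (u v : 'rV[R]_3) :
  cross u v 0 0 = u 0 1 * v 0 2%:R - u 0 2%:R * v 0 1.
Proof.
by rewrite mxE; congr (_ * _ - _ * _); congr (_ _ _); apply/val_inj.
Qed.

Lemma cross1E (R : realType) (u v : 'rV[R]_3) :
  cross u v 0 1 = u 0 2%:R * v 0 0 - u 0 0 * v 0 2%:R.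
Proof.
by rewrite mxE; congr (_ * _ - _ * _); congr (_ _ _); apply/val_inj.
Qed.

Lemma cross2E (R : realType) (u v : 'rV[R]_3) :
  cross u v 0 2%:R = u 0 0 * v 0 1 - u 0 1 * v 0 0.
Proof.
by rewrite mxE; congr (_ * _ - _ * _); congr (_ _ _); apply/val_inj.
Qed.

Lemma det3E (R : realType) (u v w : 'rV[R]_3) : det3 u v w = dot u (cross v w).
Proof.
rewrite /det3 (expand_det_row _ 0) !big_ord_recl big_ord0.
rewrite /cofactor !(expand_det_row _ 0) !big_ord_recl !big_ord0 /cofactor.
rewrite !det_mx11 !mxE /= dotE cross0E cross1E cross2E /bump /=.
(* The Laplace expansion leaves its column indices as nested [lift]s; normalizing them to [0], [1],
   [2%:R] lets [ring] see equal coordinates as equal atoms. *)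
have -> : ord0 = 0 :> 'I_3 by [].
have -> : lift 0 0 = 1 :> 'I_3 by apply/val_inj.
have -> : lift 0 (lift 0 0) = 2%:R :> 'I_3 by apply/val_inj.
have -> : lift 1 0 = 0 :> 'I_3 by apply/val_inj.
have -> : lift 1 (lift 0 0) = 2%:R :> 'I_3 by apply/val_inj.
have -> : lift 2%:R 0 = 0 :> 'I_3 by apply/val_inj.
have -> : lift 2%:R (lift 0 0) = 1 :> 'I_3 by apply/val_inj.
have -> : lift 0 (lift (lift ord0 ord0) 0) = 1 :> 'I_3 by apply/val_inj.
have -> : lift 1 (lift (lift ord0 ord0) 0) = 0 :> 'I_3 by apply/val_inj.
have -> : lift 2%:R (lift (lift ord0 ord0) 0) = 0 :> 'I_3 by apply/val_inj.
ring.
Qed.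

Definition vecE := (dotE, cross0E, cross1E, cross2E).

Lemma dot_gt0 (R : realType) (u : 'rV[R]_3) : (0 < dot u u) = (u != 0).
Proof.
have dot_ge0 : 0 <= dot u u by rewrite dotE -!expr2 !addr_ge0 ?sqr_ge0.
rewrite lt_def dot_ge0 andbT; congr (~~ _).
apply/eqP/eqP => [|->]; last by rewrite dotE !mxE !mul0r !addr0.
move=> /eqP; rewrite dotE -!expr2 !paddr_eq0 ?addr_ge0 ?sqr_ge0 //.
rewrite !sqrf_eq0 => /andP[/andP[/eqP u0 /eqP u1] /eqP u2].
by apply: rV3P; rewrite ?mxE.
Qed.

Lemma enorm_gt0 (R : realType) (u : 'rV[R]_3) : (0 < enorm u) = (u != 0).
Proof. by rewrite sqrtr_gt0 dot_gt0. Qed.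

Lemma sqr_enorm (R : realType) (u : 'rV[R]_3) : enorm u ^+ 2 = dot u u.
Proof. by rewrite sqr_sqrtr // dotE -!expr2 !addr_ge0 ?sqr_ge0. Qed.

Lemma dotZl (R : realType) (c : R) (u v : 'rV[R]_3) :
  dot (c *: u) v = c * dot u v.
Proof. by rewrite !dotE !mxE; ring. Qed.

Lemma dotZr (R : realType) (c : R) (u v : 'rV[R]_3) :
  dot u (c *: v) = c * dot u v.
Proof. by rewrite !dotE !mxE; ring. Qed.

Lemma crossuu (R : realType) (u : 'rV[R]_3) : cross u u = 0.
Proof. by apply: rV3P; rewrite !vecE mxE; ring. Qed.

Lemma cross0u (R : realType) (u : 'rV[R]_3) : cross 0 u = 0.
Proof. by apply: rV3P; rewrite !vecE !mxE; ring. Qed.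

Lemma dot_crossl (R : realType) (u v : 'rV[R]_3) : dot u (cross u v) = 0.
Proof. by rewrite !vecE; ring. Qed.

Lemma dot_crossr (R : realType) (u v : 'rV[R]_3) : dot (cross u v) v = 0.
Proof. by rewrite !vecE; ring. Qed.

Lemma dot_crossA (R : realType) (u v w : 'rV[R]_3) :
  dot (cross u v) w = dot u (cross v w).
Proof. by rewrite !vecE; ring. Qed.

(** Both inner products are orthogonal to [u], so their cross product is a multiple of [u]. With q',
    q'', q''' for [u], [v], [w], it turns the determinant condition into parallelism of q' x q'' and
    its derivative. *)
Lemma cross_cross_common (R : realType) (u v w : 'rV[R]_3) :
  cross (cross u v) (cross u w) = det3 u v w *: u.
Proof. by rewrite det3E; apply: rV3P; rewrite [RHS]mxE !vecE; ring. Qed.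

(** Cauchy-Schwarz, obtained from Lagrange's identity |u|^2 |v|^2 - <u, v>^2 = |u x v|^2. It makes
    [acos] of such a product meaningful. *)
Lemma dot_unit_bound (R : realType) (u v : 'rV[R]_3) :
  enorm u = 1 -> enorm v = 1 -> -1 <= dot u v <= 1.
Proof.
move=> u1 v1.
have : dot u v ^+ 2 <= 1.
  have -> : 1 = dot u u * dot v v by rewrite -!sqr_enorm u1 v1 expr1n mulr1.
  rewrite -subr_ge0.
  suff -> : dot u u * dot v v - dot u v ^+ 2 = dot (cross u v) (cross u v).
    by rewrite dotE -!expr2 !addr_ge0 ?sqr_ge0.
  by rewrite !vecE; ring.
by rewrite -real_normK ?num_real // expr_le1 // ler_norml.
Qed.

Lemma enorm_normalize (R : realType) (u : 'rV[R]_3) :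
  u != 0 -> enorm ((enorm u)^-1 *: u) = 1.
Proof.
rewrite -enorm_gt0 => u_gt0; rewrite {1}/enorm dotZl dotZr -sqr_enorm.
by rewrite expr2 mulKf ?gt_eqF // mulVf ?gt_eqF // sqrtr1.
Qed.

(** * Differentiation of curves in 3-space *)

Lemma is_derive_mxP (R : realType) m n (M : R -> 'M[R]_(m, n))
    (t : R) (dM : 'M[R]_(m, n)) :
  is_derive t 1 M dM <-> forall i j, is_derive t 1 (fun x => M x i j) (dM i j).
Proof.
split=> [[Mt <-] i j|dMt].
  rewrite derive_mx // mxE; apply/derivableP.
  by move/derivable_mxP: Mt; apply.
have Mt : derivable M t 1 by apply/derivable_mxP => i j; case: (dMt i j).
apply: DeriveDef => //; rewrite derive_mx //; apply/matrixP => i j.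
by rewrite mxE; case: (dMt i j).
Qed.

Lemma is_derive_rV3 (R : realType) (f : R -> 'rV[R]_3) (t : R)
    (df : 'rV[R]_3) :
  is_derive t 1 (fun x => f x 0 0) (df 0 0) ->
  is_derive t 1 (fun x => f x 0 1) (df 0 1) ->
  is_derive t 1 (fun x => f x 0 2%:R) (df 0 2%:R) ->
  is_derive t 1 f df.
Proof.
by move=> d0 d1 d2; apply/is_derive_mxP => i; rewrite ord1; elim/forall_ord3.
Qed.

Lemma is_derive_dot (R : realType) (f g : R -> 'rV[R]_3) (t : R)
    (df dg : 'rV[R]_3) :
  is_derive t 1 f df -> is_derive t 1 g dg ->
  is_derive t 1 (fun x => dot (f x) (g x)) (dot df (g t) + dot (f t) dg).
Proof.
move=> /is_derive_mxP dft /is_derive_mxP dgt.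
under eq_fun do rewrite dotE.
have dP i := is_deriveM (dft 0 i) (dgt 0 i).
apply: is_derive_eq (is_deriveD (is_deriveD (dP 0) (dP 1)) (dP 2%:R)) _.
by rewrite !dotE /GRing.scale /=; ring.
Qed.

Lemma is_derive_cross (R : realType) (f g : R -> 'rV[R]_3) (t : R)
    (df dg : 'rV[R]_3) :
  is_derive t 1 f df -> is_derive t 1 g dg ->
  is_derive t 1 (fun x => cross (f x) (g x)) (cross df (g t) + cross (f t) dg).
Proof.
move=> /is_derive_mxP dft /is_derive_mxP dgt.
have dB i j := is_deriveB (is_deriveM (dft 0 i) (dgt 0 j))
                          (is_deriveM (dft 0 j) (dgt 0 i)).
apply: is_derive_rV3; under eq_fun do rewrite ?cross0E ?cross1E ?cross2E.
- by apply: is_derive_eq (dB 1 2%:R) _; rewrite mxE !vecE /GRing.scale /=; ring.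
- by apply: is_derive_eq (dB 2%:R 0) _; rewrite mxE !vecE /GRing.scale /=; ring.
- by apply: is_derive_eq (dB 0 1) _; rewrite mxE !vecE /GRing.scale /=; ring.
Qed.

Lemma is_derive_scale (R : realType) (k : R -> R) (f : R -> 'rV[R]_3)
    (t dk : R) (df : 'rV[R]_3) :
  is_derive t 1 k dk -> is_derive t 1 f df ->
  is_derive t 1 (fun x => k x *: f x) (dk *: f t + k t *: df).
Proof.
move=> dkt /is_derive_mxP dft; apply/is_derive_mxP => i j.
under eq_fun do rewrite mxE.
apply: is_derive_eq (is_deriveM dkt (dft i j)) _.
by rewrite !mxE /GRing.scale /=; ring.
Qed.

Lemma is_derive_enorm (R : realType) (f : R -> 'rV[R]_3) (t : R)
    (df : 'rV[R]_3) :
  f t != 0 -> is_derive t 1 f df ->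
  is_derive t 1 (fun x => enorm (f x)) ((enorm (f t))^-1 * dot (f t) df).
Proof.
move=> ft_neq0 dft.
have dot_ft_gt0 : 0 < dot (f t) (f t) by rewrite dot_gt0.
have dsqrt := is_derive1_sqrt dot_ft_gt0.
apply: is_derive_eq (is_derive1_comp dsqrt (is_derive_dot dft dft)) _.
rewrite -/(enorm (f t)) invfM; set e := (enorm _)^-1; rewrite !dotE; by field.
Qed.

(** The derivative of f / |f| is the component of f' orthogonal to f, divided by |f|. The double
    cross product form makes it visibly zero when f x f' = 0. *)
Lemma is_derive_normalize (R : realType) (f : R -> 'rV[R]_3) (t : R)
    (df : 'rV[R]_3) :
  f t != 0 -> is_derive t 1 f df ->
  is_derive t 1 (fun x => (enorm (f x))^-1 *: f x)
    ((enorm (f t))^-1 ^+ 3 *: cross (cross (f t) df) (f t)).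
Proof.
move=> ft_neq0 dft; have e_gt0 : enorm (f t) != 0 by rewrite gt_eqF ?enorm_gt0.
have dV := is_deriveV (f := fun x => enorm (f x)) e_gt0
  (is_derive_enorm ft_neq0 dft).
apply: is_derive_eq (is_derive_scale dV dft) _.
have -> : cross (cross (f t) df) (f t) =
          enorm (f t) ^+ 2 *: df - dot (f t) df *: f t.
  by rewrite sqr_enorm; apply: rV3P; rewrite !vecE !mxE; ring.
rewrite [X in X *: f t](_ : _ = - ((enorm (f t))^-1 ^+ 3 * dot (f t) df)).
  rewrite scaleNr scalerBr !scalerA addrC; congr (_ *: _ - _).
  by field.
by rewrite /GRing.scale /=; field.
Qed.

(** * Constancy on an interval *)

Lemma is_interval_derive0_eq (R : realType) (D : set R) (f : R -> R) :
  is_interval D -> (forall s, D s -> is_derive s 1 f 0) ->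
  forall s t, D s -> D t -> f s = f t.
Proof.
move=> D_itv df s t; wlog : s t / s < t => [le_case|lt_st] Ds Dt.
  by case: (ltgtP s t) => [| |->//] lt_st; [|symmetry]; exact: le_case.
(* The interval hypothesis keeps the whole segment inside [D], as the mean value theorem
   requires. *)
have stD x : x \in `[s, t]%R -> D x by rewrite in_itv; exact: D_itv s t Ds Dt x.
have [x /subset_itv_oo_cc/stD/df //| |x _ /eqP] :=
  @MVT R f (fun=> 0) s t lt_st.
- by apply: derivable_within_continuous => x /stD/df [].
- by rewrite mul0r subr_eq0 => /eqP.
Qed.

(** When w' is parallel to w, only the length of w varies. The argument runs on each coordinate,
    since the mean value theorem is about real functions. *)
Lemma normalize_constant (R : realType) (D : set R) (w dw : R -> 'rV[R]_3) :
  is_interval D -> (forall s, D s -> is_derive s 1 w (dw s)) ->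
  (forall s, D s -> w s != 0) ->
  (forall s, D s -> cross (w s) (dw s) = 0) ->
  forall s t, D s -> D t ->
  (enorm (w s))^-1 *: w s = (enorm (w t))^-1 *: w t.
Proof.
move=> D_itv dwE w_neq0 w_par s t Ds Dt; apply/rowP => j.
pose n x := ((enorm (w x))^-1 *: w x) 0 j.
apply: (is_interval_derive0_eq D_itv (f := n)) => // x Dx.
have /is_derive_mxP/(_ 0 j) := is_derive_normalize (w_neq0 x Dx) (dwE x Dx).
by rewrite w_par // cross0u scaler0 mxE.
Qed.

(** * Derivatives of the ruling and the two implications *)

Lemma is_derive_derive1n (R : realType) (V : normedModType R) (D : set R)
    (f : R -> V) (n : nat) (s : R) :
  smooth_on D f -> D s -> is_derive s 1 (derive1n n f) (derive1n n.+1 f s).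
Proof.
by move=> f_smooth Ds; rewrite derive1nS derive1E; apply/derivableP/f_smooth.
Qed.

Lemma dot_constant_derive (R : realType) (D : set R) (f df : R -> 'rV[R]_3)
    (u : 'rV[R]_3) (c : R) :
  open D -> (forall s, D s -> is_derive s 1 f (df s)) ->
  (forall s, D s -> dot (f s) u = c) -> forall s, D s -> dot (df s) u = 0.
Proof.
move=> D_open dfE f_const s Ds.
have := is_derive_dot (dfE s Ds) (is_derive_cst u s 1).
have d0 : is_derive s 1 (fun x => dot (f x) u) 0.
  (* Constancy is known only on [D]; as [D] is open, it holds on a neighbourhood of [s], which
     determines the derivative. *)
  apply: (near_eq_is_derive (f := cst c)) => //.
  near=> x; rewrite /cst f_const //.
  near: x; exact: open_nbhs_nbhs.
move=> d1; rewrite -[RHS](@derive_val _ _ _ _ _ _ _ d0).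
rewrite (@derive_val _ _ _ _ _ _ _ d1) !dotE !mxE; ring.
Unshelve. all: by end_near. Qed.

(** Cramer's rule in the form det(a, b, c) u = <a, u> b x c + <b, u> c x a + <c, u> a x b: the right
    side vanishes while [u] does not. *)
Lemma det3_orthogonal (R : realType) (a b c u : 'rV[R]_3) :
  u != 0 -> dot a u = 0 -> dot b u = 0 -> dot c u = 0 -> det3 a b c = 0.
Proof.
move=> u_neq0 au bu cu; apply/eqP; rewrite det3E.
have /eqP : dot a (cross b c) *: u = 0.
  have -> : dot a (cross b c) *: u =
      dot a u *: cross b c + dot b u *: cross c a + dot c u *: cross a b.
    (* The patterns confine [mxE] to sums and multiples; otherwise it would also unfold [cross],
       whose entries are left to [vecE]. *)
    by apply: rV3P; rewrite ![fun_of_matrix (_ + _) _ _]mxE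
      ![fun_of_matrix (_ *: _) _ _]mxE !vecE; ring.
  by rewrite au bu cu !scale0r !addr0.
by rewrite scaler_eq0 (negPf u_neq0) orbF.
Qed.

Lemma q_slant_det3 (R : realType) (N : ruledSurface R) :
  q_slant N -> forall s, dom N s ->
  det3 (derive1 (ruling N) s) (derive1n 2 (ruling N) s)
       (derive1n 3 (ruling N) s) = 0.
Proof.
move=> [u [theta [u1 _ _ qu]]].
have u_neq0 : u != 0 by rewrite -enorm_gt0 u1.
have dq n s (Ds : dom N s) :=
  is_derive_derive1n n (@ruling_smooth _ N) Ds.
have qu1 := dot_constant_derive (@dom_open _ N) (dq 0) qu.
have qu2 := dot_constant_derive (@dom_open _ N) (dq 1) qu1.
have qu3 := dot_constant_derive (@dom_open _ N) (dq 2) qu2.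
move=> s Ds.
by apply: (det3_orthogonal u_neq0); [exact: qu1|exact: qu2|exact: qu3].
Qed.

(* Differentiating <a, q'> = 0 gives <a, q''> = - <a', q'> = k2 k1 <h, h>, and
   q x q' is a nonzero multiple of a. *)
Lemma ruling_triple_neq0 (R : realType) (N : ruledSurface R) (k1 k2 : R -> R)
    (s : R) :
  frenet_invariants N k1 k2 -> k2 s != 0 -> dom N s ->
  dot (ruling N s) (cross (derive1 (ruling N) s) (derive1n 2 (ruling N) s))
    != 0.
Proof.
move=> frenet k2_neq0 Ds; have [q'_neq0 q'E _ a'E] := frenet s Ds.
have dq n := is_derive_derive1n n (@ruling_smooth _ N) Ds.
have e_gt0 : 0 < enorm (derive1 (ruling N) s) by rewrite enorm_gt0.
(* The Frenet formula only gives the value of [derive1]; differentiability of the central tangent is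
   derived from its definition. *)
have da : is_derive s 1 (central_tangent N) (- k2 s *: central_normal N s).
  have e_neq0 : enorm (derive1 (ruling N) s) != 0 by rewrite gt_eqF.
  have dV := is_deriveV (f := fun x => enorm (derive1 (ruling N) x)) e_neq0
    (is_derive_enorm q'_neq0 (dq 1)).
  have := is_derive_scale dV (is_derive_cross (dq 0) (dq 1)).
  by move=> [da _]; rewrite -a'E derive1E; apply: derivableP.
have := is_derive_dot da (dq 1).
have -> : (fun x => dot (central_tangent N x) (derive1n 1 (ruling N) x)) =
    cst 0.
  apply/funext => x; rewrite /central_tangent dotZl.
  by rewrite dot_crossr mulr0.
move=> /@derive_val; rewrite derive_cst => /esym/eqP.
rewrite /central_tangent !dotZl derive1n1 dot_crossA.
apply: contraTneq => ->; rewrite mulr0 addr0 mulf_neq0 ?oppr_eq0 //.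
(* If <h, q'> were zero, then |q'|^2 = k1 <h, q'> would vanish too. *)
apply: contraTneq e_gt0 => hq'; rewrite enorm_gt0 -dot_gt0.
by rewrite {1}q'E dotZl hq' mulr0 ltxx.
Qed.

Lemma det3_q_slant (R : realType) (N : ruledSurface R) (k1 k2 : R -> R) :
  frenet_invariants N k1 k2 -> (forall s, dom N s -> k2 s != 0) ->
  (forall s, dom N s -> det3 (derive1 (ruling N) s) (derive1n 2 (ruling N) s)
                             (derive1n 3 (ruling N) s) = 0) ->
  q_slant N.
Proof.
move=> frenet k2_neq0 det0.
have [[s0 Ds0]|dom0] := pselect (exists s, dom N s); last first.
  (* On an empty domain any unit vector and any admissible angle will do. *)
  exists ((enorm (const_mx 1))^-1 *: const_mx 1), 0; split.
  - apply: enorm_normalize; apply/eqP => /rowP/(_ 0)/eqP.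
    by rewrite !mxE oner_eq0.
  - by rewrite lexx pi_ge0.
  - by rewrite lt_eqF // divr_gt0 ?pi_gt0.
  - by move=> s Ds; case: dom0; exists s.
have dq n s (Ds : dom N s) :=
  is_derive_derive1n n (@ruling_smooth _ N) Ds.
pose w s := cross (derive1 (ruling N) s) (derive1n 2 (ruling N) s).
pose dw s := cross (derive1 (ruling N) s) (derive1n 3 (ruling N) s).
have triple_neq0 s : dom N s -> dot (ruling N s) (w s) != 0.
  by move=> Ds; exact: ruling_triple_neq0 frenet (k2_neq0 s Ds) Ds.
have w_neq0 s : dom N s -> w s != 0.
  move=> Ds; apply: contraNneq (triple_neq0 s Ds) => ->.
  by rewrite dotE !mxE !mulr0 !addr0.
have dwE s : dom N s -> is_derive s 1 w (dw s).
  move=> Ds; apply: is_derive_eq (is_derive_cross (dq 1 s Ds) (dq 2 s Ds)) _.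
  by rewrite crossuu add0r.
have w_par s : dom N s -> cross (w s) (dw s) = 0.
  by move=> Ds; rewrite cross_cross_common det0 // scale0r.
pose u := (enorm (w s0))^-1 *: w s0.
have uE s : dom N s -> u = (enorm (w s))^-1 *: w s.
  move=> Ds.
  by apply: (normalize_constant (@dom_interval _ N) dwE w_neq0 w_par).
have qu s : dom N s -> dot (ruling N s) u = dot (ruling N s0) u.
  move=> Ds.
  pose g s := dot (ruling N s) u.
  apply: (is_interval_derive0_eq (f := g) (@dom_interval _ N)) => // x Dx.
  apply: is_derive_eq (is_derive_dot (dq 0 x Dx) (is_derive_cst u x 1)) _.
  (* Rewriting [u] as the normalized [w x], instead of its value at [s0], shows that it is
     orthogonal to q' at [x]. *)
  by rewrite (uE x Dx) dotZr dot_crossl mulr0 add0r dotE !mxE !mulr0 !addr0.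
have u1 : enorm u = 1 by apply: enorm_normalize; exact: w_neq0.
have := dot_unit_bound (ruling_unit Ds0) u1.
set c := dot _ _ => c_bnd; exists u, (acos c).
have cosc : cos (acos c) = c by apply: acosK; rewrite in_itv.
split=> //.
- by rewrite acos_ge0 ?acos_lepi.
(* A right angle would force [c = 0], but [c] is the triple product <q, q' x q''> at [s0] divided by
   the length of [w s0], hence nonzero. *)
- apply/eqP => c_pihalf; move: cosc; rewrite c_pihalf cos_pihalf => /esym/eqP.
  rewrite /c /u dotZr mulf_eq0 invr_eq0 (negPf (triple_neq0 _ Ds0)) orbF.
  by rewrite gt_eqF // enorm_gt0 w_neq0.
- by move=> s Ds; rewrite cosc; exact: qu.
Qed.

Theorem theorem3p2 (R : realType) (N : ruledSurface R) (k1 k2 : R -> R)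
    (c_unit_speed : unit_speed N)
    (c_striction : striction_base N)
    (frenet : frenet_invariants N k1 k2)
    (k1_neq0 : forall s, dom N s -> k1 s != 0)
    (k2_neq0 : forall s, dom N s -> k2 s != 0) :
  q_slant N <->
  (forall s, dom N s ->
     det3 (derive1 (ruling N) s) (derive1n 2 (ruling N) s) (derive1n 3 (ruling N) s) = 0).
Proof. by split; [exact: q_slant_det3|exact: det3_q_slant frenet k2_neq0]. Qed.
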